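(* Let $n \geq 4$ and let $\mathsf{IF}(n) := \big(\mathrm{inv}_y(\sigma \tau^{-1}) + \mathrm{fix}_z(\sigma \tau^{-1})\big)_{\sigma, \tau \in \mathfrak{S}_n}$. Then $\mathsf{IF}(n)$ is diagonalizable, and its spectrum is $$\mathrm{Sp}\big(\mathsf{IF}(n)\big) = \bigg\{ \frac{n!}{2} \sum_{1 \le i<j \le n} y_{i,j} + n!z,\ (n-2)!\,nz - (n-2)! \sum_{1 \le i<j \le n} (j-i)y_{i,j},\ -(n-3)! \sum_{1 \le i<j \le n} \big(n -2(j-i)\big) y_{i,j},\ (n-2)!\,nz,\ 0 \bigg\},$$ with multiplicities (1) $\mathrm{m}_{\mathsf{IF}(n)}\Big( \frac{n!}{2} \sum_{i<j} y_{i,j} + n!z \Big) = 1$; (2) $\mathrm{m}_{\mathsf{IF}(n)}\Big( (n-2)!\,nz - (n-2)! \sum_{i<j} (j-i)y_{i,j} \Big) = n-1$; (3) $\mathrm{m}_{\mathsf{IF}(n)}\Big( -(n-3)! \sum_{i<j} \big(n -2(j-i)\big) y_{i,j} \Big) = \binom{n-1}{2}$; (4) $\mathrm{m}_{\mathsf{IF}(n)}\big( (n-2)!\,nz \big) = (n-1)(n-2)$; (5) $\mathrm{m}_{\mathsf{IF}(n)}(0) = n! -\frac{n}{2}(3n-7) -3$.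
   Context: $[n]=\{1,\dots,n\}$ and $\mathfrak{S}_n$ is the symmetric group of $[n]$; products are compositions of maps. Let $z$ and $y_{i,j}$ ($1 \le i<j \le n$) be independent indeterminates over $\mathbb{R}$. For $\sigma\in\mathfrak{S}_n$, $\mathrm{Inv}\,\sigma := \{(i,j)\in[n]^2 \mid i<j,\ \sigma(i)>\sigma(j)\}$, $\mathrm{Fix}\,\sigma := \{i\in[n]\mid \sigma(i)=i\}$, $\mathrm{inv}_y\,\sigma := \sum_{(i,j)\in\mathrm{Inv}\,\sigma} y_{i,j}$, and $\mathrm{fix}_z\,\sigma := \#\mathrm{Fix}(\sigma)\, z$. $\mathsf{IF}(n)$ is an $n!\times n!$ matrix with rows and columns indexed by $\mathfrak{S}_n$ and entries in the polynomial ring $\mathbb{R}[y_{i,j} : i<j][z]$; it is regarded as a matrix over the field of fractions of that ring. $\mathrm{Sp}(\mathsf{M})$ is the set of eigenvalues of a square matrix $\mathsf{M}$ and $\mathrm{m}_{\mathsf{M}}(x)$ is the multiplicity of the eigenvalue $x$. *)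

(* Defs.v *)
From HB Require Import structures.
From mathcomp Require Import all_boot all_order all_algebra all_fingroup.
From mathcomp Require Import reals mpoly.

Set Implicit Arguments.
Unset Strict Implicit.
Unset Printing Implicit Defensive.

Import GRing.Theory.
Local Open Scope ring_scope.

(* The set [n] is represented by 'I_n, that is, shifted to {0, ..., n-1}; the
   theorem only involves the order and the differences of indices. *)

Definition ipair (n : nat) := {p : 'I_n * 'I_n | (p.1 < p.2)%N}.

Definition idx1 (n : nat) (p : ipair n) : 'I_n := (val p).1.
Definition idx2 (n : nat) (p : ipair n) : 'I_n := (val p).2.

(* R[y_{i,j} : i < j][z] *)
Definition yring (R : realType) (n : nat) := {mpoly R[#|{: ipair n}|]}.
Definition yzring (R : realType) (n : nat) := {poly yring R n}.

Definition yvar (R : realType) (n : nat) (p : ipair n) : yzring R n :=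
  ('X_(enum_rank p) : yring R n)%:P.
Definition zvar (R : realType) (n : nat) : yzring R n := 'X.

Definition Inv (n : nat) (s : {perm 'I_n}) : {set ipair n} :=
  [set p | (s (idx2 p) < s (idx1 p))%N].
Definition Fix (n : nat) (s : {perm 'I_n}) : {set 'I_n} :=
  [set i | s i == i].

Definition inv_y (R : realType) (n : nat) (s : {perm 'I_n}) : yzring R n :=
  \sum_(p in Inv s) yvar R p.
Definition fix_z (R : realType) (n : nat) (s : {perm 'I_n}) : yzring R n :=
  #|Fix s|%:R * zvar R n.

(* The product of MathComp permutations applies the left factor first:
   (s * t) x = t (s x).  Hence the composition of maps
   x |-> s (t^-1 x) is t^-1 * s. *)
Definition IF_poly (R : realType) (n : nat) :
    'M[yzring R n]_#|{: {perm 'I_n}}| :=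
  \matrix_(a, b)
    let s := enum_val a in let t := enum_val b in
    inv_y R (t^-1 * s)%g + fix_z R (t^-1 * s)%g.

Definition yzfield (R : realType) (n : nat) := {fraction yzring R n}.

Definition IF (R : realType) (n : nat) :
    'M[yzfield R n]_#|{: {perm 'I_n}}| :=
  map_mx (@tofrac (yzring R n)) (IF_poly R n).

Definition mult (F : fieldType) (m : nat) (M : 'M[F]_m) (x : F) : nat :=
  mup x (char_poly M).

(* Main.v *)
Require Import Defs.
From HB Require Import structures.
From mathcomp Require Import all_boot all_order all_algebra all_fingroup.
From mathcomp Require Import reals mpoly ring zify.

(* IF(n) is the left multiplication of the group algebra by the element
   Y + z Z, where Z(s) counts fixed points and 2 Y = S J + A with S the sum of
   the y_p, J the all-ones function and
   A(s) = sum_p y_p sign (s i - s j)  for p = (i, j).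
   The coefficients of A lie in the exterior square of the permutation
   representation, so A only acts on its two constituents V (of dimension
   n - 1) and Lambda^2 V, by operators of rank one.  Concretely, J and Z are
   central, (Z - J) / (n (n-2)!) is the idempotent of V, B = Z * A is an explicit
   multiple of s |-> sum_p y_p (s i - s j), and A * A is a combination of A and B.
   This gives a resolution of the identity into eigenprojections of IF(n), and
   the multiplicities are the traces of these projections. *)

Set Implicit Arguments.
Unset Strict Implicit.
Unset Printing Implicit Defensive.

Import GRing.Theory.
Local Open Scope ring_scope.

(** * Diagonalization from a resolution of the identity *)

Lemma char_poly_similar (F : fieldType) (N : nat) (P A B : 'M[F]_N) :
  P \in unitmx -> P *m A = B *m P -> char_poly A = char_poly B.
Proof.
move=> Pu PAB; have dP : \det (map_mx polyC P) != 0.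
  by rewrite det_map_mx polyC_eq0 -unitfE -unitmxE.
apply: (mulfI dP); rewrite /char_poly [RHS]mulrC -!det_mulmx; congr (\det _).
by rewrite /char_poly_mx mulmxBr mulmxBl -!map_mxM PAB scalar_mxC.
Qed.

(** Every polynomial satisfies p(M) E_k = p(x_k) E_k. Summing over k, the product of the X - x_k
    annihilates M; its roots are distinct, so M is diagonalizable. Likewise an eigenvector is the
    sum of its images under the E_k, and one of them is nonzero. *)
Lemma diagonalizable_resolution (F : fieldType) (N : nat) (I : finType)
    (M : 'M[F]_N) (x : I -> F) (E : I -> 'M[F]_N) :
  (0 < N)%N -> injective x -> (forall k, M *m E k = x k *: E k) ->
  \sum_k E k = 1%:M ->
  [/\ diagonalizable M,
      forall a, eigenvalue M a -> exists k, a = x k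
    & forall k, (mup (x k) (char_poly M))%:R = \tr (E k)].
Proof.
case: N M E => // N M E _ xI ME E1.
have diagM : diagonalizable M.
  apply/diagonalizableP; exists (map x (enum I)).
    by rewrite map_inj_uniq // enum_uniq.
  apply/mxminpoly_minP.
  have horE p k : horner_mx M p *m E k = p.[x k] *: E k.
    elim/poly_ind: p => [|p c IHp]; first by rewrite rmorph0 mul0mx horner0 scale0r.
    rewrite rmorphD rmorphM /= horner_mx_X horner_mx_C mulmxDl -mulmxA ME.
    by rewrite -scalemxAr IHp mul_scalar_mx hornerMXaddC scalerA mulrC scalerDl.
  rewrite -[horner_mx _ _]mulmx1 -E1 mulmx_sumr big1 // => k _.
  rewrite horE (_ : _.[x k] = 0) ?scale0r //; apply/rootP.
  by rewrite root_prod_XsubC map_f ?mem_enum.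
split=> // [a /eigenvalueP[v vM v0]|k].
  case: (pickP (fun k => a == x k)) => [k /eqP|ax]; first by exists k.
  case/eqP: v0; rewrite -[v]mulmx1 -E1 mulmx_sumr big1 // => k _.
  have /eqP : (a - x k) *: (v *m E k) = 0.
    by rewrite scalerBl scalemxAl -vM -mulmxA ME -scalemxAr subrr.
  by rewrite scaler_eq0 subr_eq0 ax => /eqP.
have [P Pu /similar_diagPex[d /(similarP Pu) Md]] := diagM.
have -> : mup (x k) (char_poly M) = #|[set i | d 0 i == x k]|.
  rewrite (char_poly_similar Pu Md) char_poly_trig ?diag_mx_is_trig //.
  under eq_bigr do rewrite mxE eqxx mulr1n.
  rewrite -(big_map (d 0) xpredT (fun y => 'X - y%:P)) /=.
  rewrite /index_enum -enumT mu_prod_XsubC.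
  rewrite count_map -sum1_count -sum1_card big_enum_cond.
  by apply: eq_bigl => i; rewrite !inE.
(* In a basis that makes M diagonal, the diagonal entry of [G l] at i is 0 unless d_i = x_l. As the
   [G l] add up to 1, the entry of [G k] is 1 exactly where d_i = x_k, and its trace counts these
   i. *)
pose G l := P *m E l *m invmx P.
have trG : \tr (E k) = \tr (G k) by rewrite /G mxtrace_mulC mulmxA mulVmx ?mul1mx.
have dG l : diag_mx d *m G l = x l *: G l.
  by rewrite /G !mulmxA -Md -!mulmxA [M *m _]mulmxA ME -!scalemxAl -scalemxAr.
have G1 : \sum_l G l = 1%:M.
  by rewrite /G -mulmx_suml -mulmx_sumr E1 mulmx1 mulmxV.
have G0 l i : d 0 i != x l -> G l i i = 0.
  move=> di; have /matrixP/(_ i i) := dG l; rewrite mul_diag_mx !mxE => /eqP.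
  by rewrite -subr_eq0 -mulrBl mulf_eq0 subr_eq0 (negPf di) => /eqP.
rewrite trG -sum1_card natr_sum big_mkcond /=; apply: eq_bigr => i _.
rewrite inE; case: eqP => [di|/eqP/G0 -> //].
have /matrixP/(_ i i) := G1; rewrite summxE (bigD1 k) //= big1 => [|l lk].
  by rewrite addr0 => ->; rewrite mxE eqxx.
by apply: G0; rewrite di (inj_eq xI) eq_sym.
Qed.

(* [J], [Z], [A], [B] satisfy the relations of the elements of the group algebra
   described at the top; [w2] and [w3] are half the nonzero eigenvalues of [A] on
   [V] and [Lambda^2 V]. *)
Section FourMatrices.
Variables (F : fieldType) (N : nat) (J Z A B : 'M[F]_N).
Variables (nu c w2 w3 kappa z s : F).
Hypotheses (nu0 : nu != 0) (c0 : c != 0) (two0 : 2%:R != 0 :> F).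
Hypotheses (w20 : w2 != 0) (w30 : w3 != 0) (kappaE : c * kappa = 2%:R * (w2 - w3)).
Hypotheses (JJ : J *m J = nu *: J) (ZJ : Z *m J = nu *: J) (JZ : J *m Z = nu *: J).
Hypotheses (AJ : A *m J = 0) (JA : J *m A = 0).
Hypotheses (ZZ : Z *m Z = c *: Z + (nu - c) *: J).
Hypotheses (ZA : Z *m A = B) (AZ : A *m Z = B).
Hypothesis AA : A *m A = (2%:R * w3) *: A + kappa *: B.

Let M := z *: Z + 2%:R^-1 *: A + (s / 2%:R) *: J.
(** (Z - J) / c is the idempotent of V: inside it, [E2] is the part where A acts by 2 w2 and [E4] is
    the rest. [E3] is A - B / c, the component of A on Lambda^2 V, divided by its eigenvalue 2
    w3. *)
Let E1 := nu^-1 *: J.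
Let E2 := (2%:R * w2 * c)^-1 *: B.
Let E3 := (2%:R * w3)^-1 *: A - (2%:R * w3 * c)^-1 *: B.
Let E4 := c^-1 *: Z - c^-1 *: J - (2%:R * w2 * c)^-1 *: B.
Let Es := [:: E1; E2; E3; E4; 1%:M - (E1 + E2 + E3 + E4)].
Let es := [:: s / 2%:R * nu + nu * z; c * z + w2; w3; c * z; 0].

Lemma four_matrices_mulmx k : (k < 5)%N -> M *m Es`_k = es`_k *: Es`_k.
Proof.
have ZB : Z *m B = c *: B.
  by rewrite -ZA mulmxA ZZ mulmxDl -!scalemxAl JA ZA scaler0 addr0.
have JB : J *m B = 0 by rewrite -AZ mulmxA JA mul0mx.
(* Multiplying the formula for A * A by Z on the right gives the coefficient 2 w3 + kappa c, which
   [kappaE] turns into 2 w2. *)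
have AB : A *m B = (2%:R * w2) *: B.
  rewrite -{1}AZ mulmxA AA mulmxDl -!scalemxAl AZ.
  have -> : B *m Z = c *: B.
    by rewrite -AZ -mulmxA ZZ mulmxDr -!scalemxAr AJ AZ scaler0 addr0.
  by rewrite scalerA -scalerDl [kappa * c]mulrC kappaE; congr (_ *: _); ring.
have kE : kappa = 2%:R * (w2 - w3) / c by rewrite -kappaE mulrC mulKf.
have rel := (JJ, ZJ, JZ, AJ, JA, ZZ, ZA, AZ, AA, ZB, JB, AB).
have H1 : M *m E1 = es`_0 *: E1.
  rewrite /M !mulmxDl -!scalemxAl -!scalemxAr !rel /= /E1.
  by apply/matrixP => i j; rewrite !mxE; field; rewrite ?nu0 ?two0.
have H2 : M *m E2 = es`_1 *: E2.
  rewrite /M !mulmxDl -!scalemxAl -!scalemxAr !rel /= /E2.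
  by apply/matrixP => i j; rewrite !mxE; field; rewrite ?w20 ?c0 ?two0.
have H3 : M *m E3 = es`_2 *: E3.
  rewrite /M !mulmxDl -!scalemxAl !mulmxBr -!scalemxAr !rel /= /E3 kE.
  by apply/matrixP => i j; rewrite !mxE; field; rewrite ?w30 ?c0 ?two0.
have H4 : M *m E4 = es`_3 *: E4.
  rewrite /M !mulmxDl -!scalemxAl !mulmxBr -!scalemxAr !rel /= /E4.
  by apply/matrixP => i j; rewrite !mxE; field; rewrite ?w20 ?c0 ?two0.
(* For the complementary projection the claim amounts to M being the sum of the four e_k E_k. *)
case: k => [|[|[|[|[|//]]]]] _ //; rewrite scale0r mulmxBr mulmx1 3!mulmxDr H1 H2 H3 H4.
rewrite /M /E1 /E2 /E3 /E4 /=.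
by apply/matrixP => i j; rewrite !mxE; field; rewrite ?w20 ?w30 ?c0 ?two0 ?nu0.
Qed.

Lemma four_matrices_spectrum : (0 < N)%N -> uniq es ->
  [/\ diagonalizable M,
      forall a, eigenvalue M a -> a \in es
    & forall k, (k < 5)%N -> (mup es`_k (char_poly M))%:R = \tr Es`_k].
Proof.
move=> N0 Ues.
have [] := @diagonalizable_resolution F N 'I_5 M (fun k => es`_k) (fun k => Es`_k) N0.
- by move=> k l /eqP; rewrite nth_uniq // => /eqP /val_inj.
- by move=> k; apply: four_matrices_mulmx.
- by rewrite !big_ord_recr big_ord0 /= add0r addrC subrK.
move=> dM eM mM; split=> // [a /eM[k ->]|k lt_k5]; first exact: mem_nth.
exact: (mM (Ordinal lt_k5)).
Qed.

End FourMatrices.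

(** * Sums over permutations *)

Section PermCount.
Variable T : finType.
Implicit Types (h : {perm T}) (c a : T) (cs bs : seq T).

(** Induction on [cs]. The permutations sending [cs] to [bs] are sorted by the image x of the next
    point c. The classes have equal size: composing with the transposition of x and a, which fixes
    [bs], carries one to another. *)
Lemma card_perm_map cs bs : uniq cs -> uniq bs -> size cs = size bs ->
  #|[set h : {perm T} | map h cs == bs]| = (#|T| - size cs)`!.
Proof.
elim: cs bs => [|c cs IH] [|a bs] //=.
  move=> _ _ _; rewrite subn0 -cardsT -card_perm cardsT; apply: eq_card => h.
  by rewrite !inE; symmetry; apply/subsetP => x _; rewrite inE.
move=> /andP[cNcs Ucs] /andP[aNbs Ubs] [szE].
have szlt : (size cs < #|T|)%N.
  rewrite -[(size cs).+1]/(size (c :: cs)) -(card_uniqP _) ?max_card //=.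
  by rewrite cNcs.
have tperm_bs x : x \notin bs -> map (tperm x a) bs = bs.
  move=> xN; rewrite -[RHS]map_id; apply/eq_in_map => y yb.
  by rewrite tpermD //; apply: contraTneq yb => <-.
pose S x := [set h : {perm T} | map h (c :: cs) == x :: bs].
have cardS x : x \notin bs -> #|S x| = #|S a|.
  move=> xN; rewrite -(card_imset _ (mulIg (tperm x a))); apply: eq_card => h.
  have mE y (g : {perm T}) : map g (c :: cs) = y :: bs ->
      map (g * tperm x a)%g (c :: cs) = tperm x a y :: bs.
    move=> /= [gc gcs]; rewrite permM gc; congr (_ :: _).
    by rewrite -[RHS](tperm_bs x) // -gcs -map_comp; apply: eq_map => u; rewrite /= permM.
  apply/imsetP/idP => [[g /[!inE] /eqP gS ->]|/[!inE] /eqP hS].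
    by rewrite (mE x) // tpermL.
  exists (h * tperm x a)%g; last by rewrite -mulgA tperm2 mulg1.
  by rewrite inE (mE a) // tpermR.
have : ((#|T| - size cs)`! = (#|T| - size cs) * #|S a|)%N.
  rewrite -(IH bs) // -sum1_card.
  rewrite (partition_big (fun h => h c) (fun x => x \notin bs)) /=; last first.
    move=> h; rewrite inE => /eqP <-; rewrite mem_map //; exact: perm_inj.
  rewrite (eq_bigr (fun=> #|S a|)) => [|x xN].
    rewrite sum_nat_const szE -(card_uniqP Ubs) -(cardC (mem bs)); congr (_ * _)%N.
    by rewrite addKn; apply: eq_card => x; rewrite !inE.
  rewrite -(cardS x) // -sum1_card; apply: eq_bigl => h.
  by rewrite !inE /= eqseq_cons andbC.
have -> : (#|T| - size cs = (#|T| - (size cs).+1).+1)%N by rewrite subnSK.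
by rewrite factS => /eqP; rewrite eqn_pmul2l // => /eqP ->.
Qed.

Lemma sum_perm_map (R : nzRingType) (phi : T -> R) e cs bs :
  uniq (e :: cs) -> uniq bs -> size cs = size bs ->
  \sum_(h : {perm T} | map h cs == bs) phi (h e)
    = ((#|T| - (size cs).+1)`!)%:R * \sum_(x | x \notin bs) phi x.
Proof.
move=> /andP[eN Ucs] Ubs szE.
rewrite (partition_big (fun h => h e) (fun x => x \notin bs)) /=; last first.
  move=> h /eqP <-; rewrite mem_map //; exact: perm_inj.
rewrite mulr_sumr; apply: eq_bigr => x xN.
rewrite -(@card_perm_map (e :: cs) (x :: bs)) /= ?eN ?xN ?szE //.
rewrite (eq_bigr (fun=> phi x)) => [|h /andP[_ /eqP-> //]].
rewrite sumr_const mulr_natl; congr (_ *+ _); apply: eq_card => h.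
by rewrite !inE eqseq_cons andbC.
Qed.

End PermCount.

(** * Sums of signs of differences over permutations *)

Section SignSums.
Variables (F : fieldType) (n : nat).
Hypothesis charF : [pchar F] =i pred0.
Implicit Types (a b c d i j : 'I_n) (h s : {perm 'I_n}).

Definition sg a b : F := (b < a)%N%:R - (a < b)%N%:R.

(** The sum of [sg a b] over b: with indices starting at 0, a of them lie below a and n - 1 - a
    above. *)
Definition sg_total a : F := 2%:R * a%:R + 1 - n%:R.

Lemma sgC a b : sg a b = - sg b a. Proof. by rewrite /sg opprB. Qed.

Lemma sgxx a : sg a a = 0. Proof. by rewrite /sg subrr. Qed.

Lemma sum_ord_ltn a : \sum_(b : 'I_n) (b < a)%N%:R = a%:R :> F.
Proof.
rewrite -natr_sum; congr _%:R; transitivity (\sum_(b < a) 1)%N.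
  rewrite (big_ord_widen n (fun=> 1%N) (ltnW (ltn_ord a))) [RHS]big_mkcond /=.
  by apply: eq_bigr => b _; case: (b < a)%N.
by rewrite sum1_card card_ord.
Qed.

Lemma sum_sg a : \sum_b sg a b = sg_total a.
Proof.
have : \sum_(b : 'I_n) ((b < a)%N%:R + (a < b)%N%:R + (b == a)%:R) = n%:R :> F.
  rewrite -[in RHS](card_ord n) -sum1_card natr_sum; apply: eq_bigr => b _.
  by rewrite -val_eqE /=; case: ltngtP; rewrite ?addr0 ?add0r.
have e1 : \sum_(b : 'I_n) (b == a)%:R = 1 :> F.
  by rewrite (bigD1 a) //= eqxx big1 ?addr0 // => b /negPf->.
rewrite !big_split /= sum_ord_ltn e1.
by rewrite /sg_total sumrN => <-; ring.
Qed.

(** Exchanging the values at i and j permutes the summation range and negates every term, and 2 is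
    nonzero in [F]. *)
Lemma sum_perm_sg_anti (P : pred {perm 'I_n}) i j :
  (forall h, P (tperm i j * h)%g = P h) -> \sum_(h | P h) sg (h i) (h j) = 0.
Proof.
move=> Pt; set S := \sum_(h | _) _.
have SN : S = - S.
  rewrite {1}/S (reindex_inj (mulgI (tperm i j))) /= -sumrN.
  by apply: eq_big => h //; rewrite !permM tpermL tpermR sgC.
have /eqP : S *+ 2 = 0 by rewrite mulr2n {2}SN subrr.
by rewrite -mulr_natr mulf_eq0 ((pcharf0P _).1 charF) orbF => /eqP.
Qed.

Lemma sum_perm_sg1 c d a : c != d ->
  \sum_(h : {perm 'I_n} | h c == a) sg (h c) (h d)
    = ((n - 2)`!)%:R * sg_total a.
Proof.
move=> cd; under eq_bigr => h /eqP-> do over.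
have := @sum_perm_map _ F (sg a) d [:: c] [:: a].
rewrite /= inE eq_sym cd card_ord => /(_ isT isT erefl) H.
under eq_bigl => h do rewrite -[_ == a]andbT -[_ && _]/([:: h c] == [:: a]).
rewrite {}H; congr (_ * _); rewrite -sum_sg [RHS](bigD1 a) //= sgxx add0r.
by apply: eq_bigl => x; rewrite inE.
Qed.

Section TwoValues.
Variables a b c d : 'I_n.
Hypotheses (ab : a != b) (cd : c != d).
Let Q h := (h c == a) && (h d == b).

Lemma sum_perm_sg2_eq :
  \sum_(h : {perm 'I_n} | Q h) sg (h c) (h d) = ((n - 2)`!)%:R * sg a b.
Proof.
rewrite (eq_bigr (fun=> sg a b)) => [|h /andP[/eqP-> /eqP->] //].
rewrite sumr_const mulr_natl; congr (_ *+ _).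
have := @card_perm_map _ [:: c; d] [:: a; b].
rewrite /= !inE ab cd card_ord => /(_ isT isT erefl) <-.
by apply: eq_card => h; rewrite !inE /Q !eqseq_cons andbT.
Qed.

Lemma sum_perm_sg2_one i : i != c -> i != d ->
  \sum_(h : {perm 'I_n} | Q h) sg (h c) (h i)
    = ((n - 3)`!)%:R * (sg_total a - sg a b).
Proof.
move=> ic id; rewrite (eq_bigr (fun h => sg a (h i))) => [|h /andP[/eqP-> _] //].
have := @sum_perm_map _ F (sg a) i [:: c; d] [:: a; b].
rewrite /= !inE negb_or ab cd ic id card_ord => /(_ isT isT erefl) H.
under eq_bigl => h do rewrite /Q -[_ == b]andbT -[_ && _]/([:: h c; h d] == [:: a; b]).
rewrite {}H; congr (_ * _); rewrite -sum_sg [in RHS](bigD1 a) //= sgxx add0r.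
rewrite [in RHS](bigD1 b) 1?[b == a]eq_sym //= [RHS]addrC addKr.
by apply: eq_bigl => x; rewrite !inE negb_or.
Qed.

End TwoValues.

(** The three terms correspond to {i, j} meeting {c, d} in both points, in c only, or in d only; in
    the disjoint case the sum cancels by antisymmetry. Kronecker deltas replace the case distinction
    so that the result can be summed over c and d. *)
Lemma sum_perm_sg2 a b c d i j : a != b -> c != d -> i != j ->
  \sum_(h : {perm 'I_n} | (h c == a) && (h d == b)) sg (h i) (h j) =
    ((n - 2)`!)%:R * sg a b * ((i == c)%:R * (j == d)%:R - (i == d)%:R * (j == c)%:R)
  + ((n - 3)`!)%:R * (sg_total a - sg a b)
      * ((i == c)%:R * (1 - (j == d)%:R) - (j == c)%:R * (1 - (i == d)%:R))
  + ((n - 3)`!)%:R * (sg_total b + sg a b)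
      * ((i == d)%:R * (1 - (j == c)%:R) - (j == d)%:R * (1 - (i == c)%:R)).
Proof.
move=> ab cd ij.
have [ba dc] : b != a /\ d != c by rewrite eq_sym ab eq_sym cd.
have swap k l : \sum_(h : {perm 'I_n} | (h c == a) && (h d == b)) sg (h k) (h l)
    = - \sum_(h : {perm 'I_n} | (h c == a) && (h d == b)) sg (h l) (h k).
  by rewrite -sumrN; apply: eq_bigr => h _; rewrite sgC.
have two l : l != c -> l != d ->
    \sum_(h : {perm 'I_n} | (h c == a) && (h d == b)) sg (h d) (h l)
      = ((n - 3)`!)%:R * (sg_total b + sg a b).
  move=> lc ld; under eq_bigl => h do rewrite andbC.
  by rewrite sum_perm_sg2_one // (sgC b) opprK.
have [ic|ic] := eqVneq i c.
  move: ij; rewrite ic (negPf cd) eq_sym => /negPf jc; rewrite jc.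
  have [->|jd] := eqVneq j d; first by rewrite sum_perm_sg2_eq //=; ring.
  by rewrite sum_perm_sg2_one ?jc //=; ring.
have [id|id] := eqVneq i d.
  move: ij; rewrite id eq_sym => /negPf jd; rewrite jd.
  have [->|jc] := eqVneq j c; first by rewrite swap sum_perm_sg2_eq //=; ring.
  by rewrite two ?jd //=; ring.
have [jc|jc] := eqVneq j c.
  by rewrite jc (negPf cd) swap sum_perm_sg2_one //=; ring.
have [jd|jd] := eqVneq j d; first by rewrite jd swap two //=; ring.
rewrite sum_perm_sg_anti /=; first by ring.
by move=> h; rewrite !permM !tpermD // eq_sym.
Qed.

Lemma sum_delta i (f : 'I_n -> F) : \sum_c (i == c)%:R * f c = f i.
Proof.
rewrite (bigD1 i) //= eqxx mul1r big1 ?addr0 // => c.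
by rewrite eq_sym => /negPf->; rewrite mul0r.
Qed.

(* By Schur's lemma the left-hand side, as a function of (a, b), is a combination
   of [sg a b] and of its projection to [V], which is proportional to [a - b]. *)
Lemma sum_perm_sg_inv a b i j : (3 <= n)%N -> a != b -> i != j ->
  \sum_(h : {perm 'I_n}) sg (h i) (h j) * sg ((h^-1)%g a) ((h^-1)%g b) =
    2%:R * ((n - 2)`!)%:R * sg a b * sg i j
  + 4%:R * ((n - 3)`!)%:R * (a%:R - b%:R - sg a b) * (i%:R - j%:R - sg i j).
Proof.
move=> n3 ab ij.
pose P c d (h : {perm 'I_n}) := (h c == a) && (h d == b).
pose G c d := \sum_(h | P c d h) sg (h i) (h j).
(* The permutations are sorted by the preimages c and d of a and b. *)
transitivity (\sum_c \sum_d sg c d * G c d).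
  rewrite pair_big /= (partition_big (fun h => ((h^-1)%g a, (h^-1)%g b)) xpredT) //=.
  apply: eq_bigr => -[c d] _ /=; rewrite /G mulr_sumr; apply: eq_big => h.
    by rewrite xpair_eqE /P !(can2_eq (permK h) (permKV h)) (eq_sym c) (eq_sym d).
  by move=> /eqP[-> ->]; rewrite mulrC.
set m2 := ((n - 2)`!)%:R; set m3 := ((n - 3)`!)%:R.
pose u := m3 * (sg_total a - sg a b); pose v := m3 * (sg_total b + sg a b).
(* The formula for [G c d] holds only for c != d, but on the diagonal the factor [sg c c] vanishes.
   Expanding it, the products of two deltas collect the coefficient m2 sg a b - u + v, up to
   sign. *)
transitivity (\sum_c ((i == c)%:R * \sum_d ((j == d)%:R * ((m2 * sg a b - u + v) * sg c d))
   - (j == c)%:R * \sum_d ((i == d)%:R * ((m2 * sg a b - u + v) * sg c d))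
   + u * ((i == c)%:R * \sum_d sg c d) - u * ((j == c)%:R * \sum_d sg c d)
   + v * \sum_d ((i == d)%:R * sg c d) - v * \sum_d ((j == d)%:R * sg c d))).
  apply: eq_bigr => c _; rewrite !mulr_sumr -!sumrN -!big_split /=.
  apply: eq_bigr => d _; have [->|cd] := eqVneq c d.
    by rewrite sgxx; ring.
  rewrite /G /P sum_perm_sg2 // -/m2 -/m3 /u /v; ring.
rewrite !big_split /= !sumrN -!mulr_sumr.
have pair k l x : \sum_c (k == c)%:R * \sum_d (l == d)%:R * (x * sg c d) = x * sg k l.
  by under eq_bigr do rewrite sum_delta; rewrite (sum_delta k (fun c => x * sg c l)).
have fst k : \sum_c (k == c)%:R * \sum_d sg c d = sg_total k.
  by rewrite sum_delta sum_sg.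
have snd k : \sum_c \sum_d (k == d)%:R * sg c d = - sg_total k.
  by under eq_bigr do rewrite sum_delta sgC; rewrite sumrN sum_sg.
rewrite !pair !fst !snd.
rewrite [sg j i]sgC /u /v /sg_total; ring.
Qed.

End SignSums.

(** * The group algebra *)

Section GroupAlgebra.
Variables (F : fieldType) (n : nat).
Implicit Types (f g : {perm 'I_n} -> F) (h s : {perm 'I_n}).

(** The product of the group algebra for composition of maps: s is h followed by [(h^-1 * s)%g].
    With this order [group_mx] is multiplicative. *)
Definition conv f g s : F := \sum_h f (h^-1 * s)%g * g h.

Definition group_mx f : 'M[F]_#|{: {perm 'I_n}}| :=
  \matrix_(a, b) f ((enum_val b)^-1 * enum_val a)%g.

Lemma group_mxM f g : group_mx f *m group_mx g = group_mx (conv f g).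
Proof.
apply/matrixP => a b; rewrite !mxE /conv.
under eq_bigr do rewrite !mxE.
rewrite -(big_enum_val (fun u => f (u^-1 * enum_val a)%g * g ((enum_val b)^-1 * u)%g)) /=.
rewrite (reindex_inj (mulgI (enum_val b))) /=.
by apply: eq_bigr => h _; rewrite mulKg invMg mulgA.
Qed.

Lemma eq_group_mx f g : f =1 g -> group_mx f = group_mx g.
Proof. by move=> fg; apply/matrixP => a b; rewrite !mxE. Qed.

Lemma group_mx_lin u f v g :
  group_mx (fun s => u * f s + v * g s) = u *: group_mx f + v *: group_mx g.
Proof. by apply/matrixP => a b; rewrite !mxE. Qed.

Lemma mxtrace_group_mx f : \tr (group_mx f) = (n`!)%:R * f 1%g.
Proof.
rewrite /mxtrace (eq_bigr (fun=> f 1%g)) => [|a _]; last by rewrite mxE mulVg.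
by rewrite sumr_const card_ord card_Sn mulr_natl.
Qed.

Lemma conv1l f s : conv (fun=> 1) f s = \sum_h f h.
Proof. by apply: eq_bigr => h _; rewrite mul1r. Qed.

Lemma conv_rev f g s : conv f g s = \sum_h f h * g (s * h^-1)%g.
Proof.
rewrite /conv (reindex_inj (inj_comp (mulgI s) (@invg_inj _))) /=.
by apply: eq_bigr => h _; rewrite invMg invgK mulgKV.
Qed.

Lemma conv1r f s : conv f (fun=> 1) s = \sum_h f h.
Proof. by rewrite conv_rev; apply: eq_bigr => h _; rewrite mulr1. Qed.

Definition fixc s : F := #|Fix s|%:R.

Lemma fixcE s : fixc s = \sum_k (s k == k)%:R.
Proof.
rewrite /fixc -sum1_card natr_sum big_mkcond /=; apply: eq_bigr => k _.
by rewrite inE; case: eqP.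
Qed.

Lemma fixc_mulVg h s : fixc (h^-1 * s)%g = \sum_k (h k == s k)%:R.
Proof.
rewrite fixcE (reindex_inj (@perm_inj _ h)) /=; apply: eq_bigr => k _.
by rewrite permM permK eq_sym.
Qed.

Lemma fixc_mulgV h s : fixc (s * h^-1)%g = \sum_k (h k == s k)%:R.
Proof.
rewrite fixcE; apply: eq_bigr => k _; rewrite permM.
by rewrite (can2_eq (permKV h) (permK h)) eq_sym.
Qed.

Lemma conv_fixl f s : conv fixc f s = \sum_k \sum_(h : {perm 'I_n} | h k == s k) f h.
Proof.
rewrite /conv; under eq_bigr do rewrite fixc_mulVg mulr_suml.
rewrite exchange_big; apply: eq_bigr => k _ /=; rewrite [RHS]big_mkcond /=.
by apply: eq_bigr => h _; case: eqP; rewrite ?mul1r ?mul0r.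
Qed.

(** The fixed-point count is a class function: on either quotient of s by h it counts the points
    where h and s agree. *)
Lemma conv_fixC f s : conv f fixc s = conv fixc f s.
Proof.
rewrite conv_rev; apply: eq_bigr => h _.
by rewrite fixc_mulVg fixc_mulgV mulrC.
Qed.

Lemma card_perm1 (k a : 'I_n) : #|[pred h : {perm 'I_n} | h k == a]| = (n - 1)`!.
Proof.
have := @card_perm_map _ [:: k] [:: a] isT isT erefl.
by rewrite card_ord => <-; apply: eq_card => h; rewrite !inE eqseq_cons andbT.
Qed.

Lemma card_perm2 (k l a b : 'I_n) : k != l ->
  #|[pred h : {perm 'I_n} | (h k == a) && (h l == b)]| =
    if a == b then 0%N else (n - 2)`!.
Proof.
move=> kl; case: eqP => [<-|/eqP ab].
  apply: eq_card0 => h; rewrite !inE; apply: contraNF kl => /andP[/eqP<-].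
  by rewrite (inj_eq perm_inj) eq_sym.
have := @card_perm_map _ [:: k; l] [:: a; b].
rewrite /= !inE kl ab card_ord => /(_ isT isT erefl) <-.
by apply: eq_card => h; rewrite !inE !eqseq_cons andbT.
Qed.

Lemma sum_fixc : (0 < n)%N -> \sum_s fixc s = (n`!)%:R.
Proof.
move=> n0.
under eq_bigr do rewrite fixcE.
rewrite exchange_big /= (eq_bigr (fun=> ((n - 1)`!)%:R)) => [|k _].
  rewrite sumr_const card_ord -mulrnA.
  by case: (n) n0 => // m _; rewrite factS subn1 mulnC.
rewrite -(card_perm1 k k) -sum1_card natr_sum [RHS]big_mkcond /=.
by apply: eq_bigr => h _; rewrite inE; case: eqP.
Qed.

Lemma natr_fact i : (i < n)%N ->
  ((n - i)`!)%:R = (n%:R - i%:R) * ((n - i.+1)`!)%:R :> F.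
Proof.
move=> lt_in; rewrite subnS -natrB 1?ltnW // -natrM.
by rewrite -{1 2}(prednK (n := n - i)) ?subn_gt0 // factS.
Qed.

(** Among the h with h k = s k, the point k is fixed by all (n-1)! of them if s k = k and by none
    otherwise; another point i is fixed by (n-2)! of them, unless i = s k. *)
Lemma conv_fix_fix s : (2 <= n)%N ->
  conv fixc fixc s = ((n - 2)`!)%:R * n%:R * fixc s
                   + ((n - 2)`!)%:R * (n%:R * n%:R - 2%:R * n%:R).
Proof.
move=> n2; set m := ((n - 2)`!)%:R.
have inner k : \sum_(h : {perm 'I_n} | h k == s k) fixc h =
    m * n%:R * (s k == k)%:R + m * (n%:R - 2%:R).
  under eq_bigr do rewrite fixcE.
  rewrite exchange_big /= (bigD1 k) //=.
  rewrite (eq_bigr (fun i => m * (1 - (s k == i)%:R))) => [|i ik]; last first.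
    under eq_bigr do rewrite mulrb.
    rewrite -big_mkcondr /= sumr_const.
    have := @card_perm2 k i (s k) i; rewrite eq_sym ik => /(_ isT) ->.
    by case: eqP => _; rewrite ?subrr ?subr0 ?mulr0 ?mulr1.
  have -> : \sum_(h : {perm 'I_n} | h k == s k) (h k == k)%:R
      = m * (n%:R - 1) * (s k == k)%:R.
    have [sk|sk] := eqVneq (s k) k.
      rewrite mulr1 mulrC -(@natr_fact 1%N) // -(card_perm1 k (s k)) -sum1_card natr_sum.
      by apply: eq_bigr => h /eqP ->; rewrite sk eqxx.
    by rewrite mulr0 big1 // => h /eqP ->; rewrite (negPf sk).
  have : \sum_i (1 - (s k == i)%:R) = n%:R - 1 :> F.
    rewrite sumrB sumr_const card_ord; congr (_ - _).
    by rewrite (bigD1 (s k)) //= eqxx big1 ?addr0 // => i; rewrite eq_sym => /negPf->.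
  rewrite (bigD1 k) //= -mulr_sumr => /(canRL (addKr _)) ->.
  ring.
rewrite conv_fixl (eq_bigr _ (fun k _ => inner k)) big_split /= -mulr_sumr -fixcE.
rewrite sumr_const card_ord -mulr_natr; ring.
Qed.

End GroupAlgebra.

(** * Products of the inversion element in the group algebra *)

Lemma idx_lt n (p : ipair n) : (idx1 p < idx2 p)%N.
Proof. exact: valP p. Qed.

Lemma idx_neq n (p : ipair n) : idx1 p != idx2 p.
Proof. by rewrite neq_ltn idx_lt. Qed.

Section InversionElement.
Variables (F : fieldType) (n : nat) (y : ipair n -> F).
Hypotheses (charF : [pchar F] =i pred0) (n3 : (3 <= n)%N).
Implicit Types (h s : {perm 'I_n}) (p q : ipair n).

Definition gap p : F := (idx2 p)%:R - (idx1 p)%:R.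
(** [sgn_inv] is the function A, and [displ] is B without its factor 2 (n-2)!. *)
Definition sgn_inv s : F := \sum_p y p * sg F (s (idx1 p)) (s (idx2 p)).
Definition displ s : F := \sum_p y p * ((s (idx1 p))%:R - (s (idx2 p))%:R).

Lemma sgn_inv1 : sgn_inv 1%g = - \sum_p y p.
Proof.
rewrite -sumrN; apply: eq_bigr => p _; rewrite !perm1 /sg idx_lt.
by rewrite ltnNge ltnW ?idx_lt // sub0r mulrN1.
Qed.

Lemma displ1 : displ 1%g = - \sum_p gap p * y p.
Proof. by rewrite -sumrN; apply: eq_bigr => p _; rewrite !perm1 /gap; ring. Qed.

(** For i < j the indicator of an inversion is half of 1 + sign (s i - s j), as s is injective. *)
Lemma sum_inv_y s :
  2%:R * \sum_(p in Inv s) y p = \sum_p y p + sgn_inv s.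
Proof.
rewrite big_mkcond mulr_sumr -big_split /=; apply: eq_bigr => p _.
have := idx_neq p; rewrite inE /sg -(inj_eq (@perm_inj _ s)) -val_eqE /=.
by case: ltngtP => //= _ _; ring.
Qed.

Lemma sum_sgn_inv : \sum_s sgn_inv s = 0.
Proof.
rewrite exchange_big big1 // => p _ /=; rewrite -mulr_sumr.
by rewrite (sum_perm_sg_anti charF (P := xpredT)) ?mulr0.
Qed.

(** For a pair (i, j), only the agreement points k = i and k = j of h and s contribute: for any
    other k, exchanging i and j preserves the condition h k = s k and reverses the sign. *)
Lemma conv_fix_sgn_inv s :
  conv (@fixc F n) sgn_inv s = 2%:R * ((n - 2)`!)%:R * displ s.
Proof.
rewrite conv_fixl /sgn_inv; under eq_bigr do rewrite exchange_big.
rewrite exchange_big mulr_sumr; apply: eq_bigr => p _ /=.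
under eq_bigr do rewrite -mulr_sumr.
have ij := idx_neq p; set i := idx1 p in ij *; set j := idx2 p in ij *.
rewrite -mulr_sumr (bigD1 i) //= (bigD1 j) 1?[j == i]eq_sym //=.
rewrite [X in _ + (_ + X)]big1 => [|k /andP[ki kj]].
  rewrite sum_perm_sg1 // (eq_bigr _ (fun h _ => sgC F (h i) (h j))) sumrN.
  by rewrite sum_perm_sg1 1?eq_sym // /sg_total; ring.
rewrite (sum_perm_sg_anti charF) // => h.
by rewrite permM tpermD // eq_sym.
Qed.

(** Expanding over two pairs p and q, each term is [sum_perm_sg_inv] at the indices of p and the
    images under s of those of q. The indices of p are increasing, so their sign is -1 and their
    difference is minus the gap. *)
Lemma conv_sgn_inv_sgn_inv s :
  conv sgn_inv sgn_inv s =
    - 2%:R * ((n - 3)`!)%:R * (\sum_p (n%:R - 2%:R * gap p) * y p) * sgn_inv s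
  + 4%:R * ((n - 3)`!)%:R * (\sum_p (1 - gap p) * y p) * displ s.
Proof.
rewrite conv_rev; set m := ((n - 3)`!)%:R.
have term p q : \sum_(h : {perm 'I_n}) (y p * sg F (h (idx1 p)) (h (idx2 p))) *
      (y q * sg F ((s * h^-1)%g (idx1 q)) ((s * h^-1)%g (idx2 q))) =
    (- 2%:R * m * ((n%:R - 2%:R * gap p) * y p)) *
      (y q * sg F (s (idx1 q)) (s (idx2 q)))
  + (4%:R * m * ((1 - gap p) * y p)) *
      (y q * ((s (idx1 q))%:R - (s (idx2 q))%:R)).
  rewrite (eq_bigr (fun h : {perm 'I_n} => y p * y q * (sg F (h (idx1 p)) (h (idx2 p)) *
      sg F ((h^-1)%g (s (idx1 q))) ((h^-1)%g (s (idx2 q)))))); last first.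
    by move=> h _; rewrite !permM; ring.
  rewrite -mulr_sumr sum_perm_sg_inv ?(inj_eq perm_inj) ?idx_neq //.
  have -> : sg F (idx1 p) (idx2 p) = -1.
    by rewrite /sg idx_lt ltnNge ltnW ?idx_lt // sub0r.
  by rewrite natr_fact // -/m /gap; ring.
under eq_bigr do rewrite /sgn_inv mulr_suml; rewrite exchange_big /=.
under eq_bigr do under eq_bigr do rewrite mulr_sumr.
under eq_bigr do rewrite exchange_big /=.
under eq_bigr do under eq_bigr do rewrite term.
under eq_bigr do rewrite big_split -!mulr_sumr /=.
by rewrite big_split -!mulr_suml -!mulr_sumr.
Qed.

End InversionElement.

(** * The spectrum *)

Lemma natr_inj_pchar0 (F : fieldType) : [pchar F] =i pred0 ->
  injective (fun m => m%:R : F).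
Proof.
move=> charF k l; wlog le_kl : k l / (k <= l)%N => [th|/esym/eqP].
  by case/orP: (leq_total k l) => [/th//|/th/[swap] /esym E /(_ E)].
rewrite -subr_eq0 -natrB // ((pcharf0P _).1 charF) subn_eq0 => le_lk.
by apply/eqP; rewrite eqn_leq le_kl le_lk.
Qed.

Lemma binom2E k : (2 <= k)%N -> (2 * 'C(k - 1, 2) = (k - 1) * (k - 2))%N.
Proof.
case: k => [|[|k]] // _.
by rewrite mulnC (bin_ffact _ 2) !ffactnS ffactn0 !subSS !subn0 muln1.
Qed.

(** This makes the multiplicity of 0 positive. At n = 3 both sides would equal 6. *)
Lemma fact_gt_dims n : (4 <= n)%N ->
  (1 + (n - 1) + 'C(n - 1, 2) + (n - 1) * (n - 2) < n`!)%N.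
Proof.
case: n => [|[|[|[|n]]]] // _; rewrite !factS.
have := binom2E (isT : (2 <= n.+4)%N); have := fact_gt0 n; nia.
Qed.

Section Spectrum.
Variables (F : fieldType) (n : nat) (y : ipair n -> F) (z : F).
Hypotheses (charF : [pchar F] =i pred0) (n4 : (4 <= n)%N).

Let e1 := (n`!)%:R / 2%:R * (\sum_p y p) + (n`!)%:R * z.
Let e2 := ((n - 2)`!)%:R * n%:R * z - ((n - 2)`!)%:R * (\sum_p gap F p * y p).
Let e3 := - ((n - 3)`!)%:R * (\sum_p (n%:R - 2%:R * gap F p) * y p).
Let e4 := ((n - 2)`!)%:R * n%:R * z.
Hypothesis Ues : uniq [:: e1; e2; e3; e4; 0].

Let M := group_mx (fun s => \sum_(p in Inv s) y p + fixc F s * z).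

Lemma spectrum_inv_fix :
  [/\ diagonalizable M,
      forall x, eigenvalue M x <-> x \in [:: e1; e2; e3; e4; 0]
    & [/\ mult M e1 = 1%N,
          mult M e2 = (n - 1)%N,
          mult M e3 = 'C(n - 1, 2),
          mult M e4 = ((n - 1) * (n - 2))%N
        & (mult M 0 + (1 + (n - 1) + 'C(n - 1, 2) + (n - 1) * (n - 2)) = n`!)%N]].
Proof.
have nat0 k : (0 < k)%N -> k%:R != 0 :> F by rewrite ((pcharf0P _).1 charF) lt0n.
have [n0 n2 n3 n12] : [/\ 0 < n, 2 <= n, 3 <= n & 2 <= n - 1]%N by split; lia.
pose S := \sum_p y p; pose G := \sum_p gap F p * y p.
pose m := ((n - 3)`!)%:R : F.
have two0 : 2%:R != 0 :> F by apply: nat0.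
have m0 : m != 0 by apply: nat0; apply: fact_gt0.
have nr0 : n%:R != 0 :> F by apply: nat0.
have nr1 : n%:R - 1 != 0 :> F by rewrite -[1]/1%:R -natrB // nat0 ?subn_gt0.
have nr2 : n%:R - 2%:R != 0 :> F by rewrite -natrB // nat0 ?subn_gt0.
have m2E : ((n - 2)`!)%:R = (n%:R - 2%:R) * m by rewrite natr_fact.
have nuE : (n`!)%:R = n%:R * (n%:R - 1) * ((n%:R - 2%:R) * m).
  by rewrite -[in LHS](subn0 n) natr_fact // (natr_fact _ n2) m2E subr0 mulrA.
have sumE : \sum_p (n%:R - 2%:R * gap F p) * y p = n%:R * S - 2%:R * G.
  by rewrite !mulr_sumr -sumrB; apply: eq_bigr => p _; ring.
have sum1E : \sum_p (1 - gap F p) * y p = S - G.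
  by rewrite -sumrB; apply: eq_bigr => p _; ring.
pose J := group_mx (fun _ : {perm 'I_n} => 1 : F).
pose Z := group_mx (@fixc F n); pose A := group_mx (sgn_inv y).
pose B := (2%:R * ((n - 2)`!)%:R) *: group_mx (displ y).
pose c := ((n - 2)`!)%:R * n%:R : F.
pose w2 := - (((n - 2)`!)%:R * G); pose w3 := - m * (n%:R * S - 2%:R * G).
(* The coefficient 4 m (S - G) of [displ] in A * A, divided by the factor 2 (n-2)! contained in
   B. *)
pose kappa := 2%:R * m * (S - G) / ((n - 2)`!)%:R.
have c0 : c != 0 by rewrite /c m2E !mulf_neq0.
have ME : M = z *: Z + 2%:R^-1 *: A + (S / 2%:R) *: J.
  apply/matrixP => a b; rewrite !mxE; set s := (_ * _)%g.
  have -> : \sum_(p in Inv s) y p = 2%:R^-1 * (S + sgn_inv y s).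
    by rewrite -sum_inv_y mulKf.
  by field.
have gmxZ u f : u *: group_mx f = group_mx (fun s => u * f s) :> 'M[F]_#|{: {perm 'I_n}}|.
  by apply/matrixP => a b; rewrite !mxE.
have const f g u : (forall s, conv f g s = u) -> group_mx f *m group_mx g = u *: J.
  move=> fg; rewrite group_mxM gmxZ; apply: eq_group_mx => s.
  by rewrite fg mulr1.
have JJ : J *m J = (n`!)%:R *: J.
  apply: const => s; rewrite conv1l sumr_const card_Sn //.
have ZJ : Z *m J = (n`!)%:R *: J by apply: const => s; rewrite conv1r sum_fixc.
have JZ : J *m Z = (n`!)%:R *: J by apply: const => s; rewrite conv1l sum_fixc.
have AJ : A *m J = 0 by rewrite (const _ _ 0) ?scale0r // => s; rewrite conv1r sum_sgn_inv.
have JA : J *m A = 0 by rewrite (const _ _ 0) ?scale0r // => s; rewrite conv1l sum_sgn_inv.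
have ZZ : Z *m Z = c *: Z + ((n`!)%:R - c) *: J.
  rewrite group_mxM -group_mx_lin; apply: eq_group_mx => s.
  by rewrite conv_fix_fix // /c nuE m2E; ring.
have ZA : Z *m A = B.
  by rewrite group_mxM /B gmxZ; apply: eq_group_mx => s; rewrite conv_fix_sgn_inv.
have AZ : A *m Z = B.
  rewrite group_mxM /B gmxZ; apply: eq_group_mx => s.
  by rewrite conv_fixC conv_fix_sgn_inv.
have AA : A *m A = (2%:R * w3) *: A + kappa *: B.
  rewrite group_mxM /B scalerA -group_mx_lin; apply: eq_group_mx => s.
  rewrite conv_sgn_inv_sgn_inv // sumE sum1E -/m /w3 /kappa m2E; field.
  by rewrite nr2 m0.
have kappaE : c * kappa = 2%:R * (w2 - w3).
  by rewrite /c /kappa /w2 /w3 m2E; field; rewrite nr2 m0.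
have e1E : e1 = S / 2%:R * (n`!)%:R + (n`!)%:R * z by rewrite /e1 -/S; field.
have e2E : e2 = c * z + w2 by [].
have e3E : e3 = w3 by rewrite /e3 sumE.
(* These are the distinctness of [e2] from [e4] and of [e3] from 0. *)
have [w20 w30] : w2 != 0 /\ w3 != 0.
  move: Ues; rewrite /= !inE !negb_or -e3E => /and5P[_ /and3P[_ e24 _] /andP[_ ->] _ _].
  by split=> //; apply: contraNneq e24 => w; rewrite e2E w addr0.
have N0 : (0 < #|{: {perm 'I_n}}|)%N by rewrite card_Sn fact_gt0.
have nu0 : (n`!)%:R != 0 :> F by apply: nat0; apply: fact_gt0.
have := @four_matrices_spectrum F _ J Z A B (n`!)%:R c w2 w3 kappa z S
  nu0 c0 two0 w20 w30 kappaE JJ ZJ JZ AJ JA ZZ ZA AZ AA N0.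
rewrite -ME -e1E -e2E -e3E => /(_ Ues)[dM eM mM].
have trJ : \tr J = (n`!)%:R by rewrite mxtrace_group_mx mulr1.
have trZ : \tr Z = (n`!)%:R * n%:R.
  rewrite mxtrace_group_mx fixcE (eq_bigr (fun=> 1)) => [|k _]; last by rewrite perm1 eqxx.
  by rewrite sumr_const card_ord.
have trA : \tr A = - ((n`!)%:R * S) by rewrite mxtrace_group_mx sgn_inv1 mulrN.
have trB : \tr B = (n`!)%:R * (2%:R * w2).
  by rewrite mxtraceZ mxtrace_group_mx displ1 -/G /w2; ring.
have C2 : ('C(n - 1, 2))%:R = (n%:R - 1) * (n%:R - 2%:R) / 2%:R :> F.
  apply: (mulfI two0); rewrite mulrCA divff // mulr1 -natrM binom2E //.
  by rewrite natrM !natrB.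
(* The traces give the multiplicities only as elements of [F]; characteristic 0 brings them back to
   natural numbers. *)
have inj := natr_inj_pchar0 charF.
have tr1 : mult M e1 = 1%N.
  by apply: inj; rewrite /= (mM 0%N) //= mxtraceZ trJ mulVf.
have tr2 : mult M e2 = (n - 1)%N.
  apply: inj; rewrite /= (mM 1%N) //= mxtraceZ trB natrB // nuE /c m2E.
  by field; rewrite w20 nr0 nr2 m0 two0.
have tr3 : mult M e3 = 'C(n - 1, 2).
  apply: inj; rewrite /= (mM 2%N) //= C2 raddfB /= 2!mxtraceZ trA trB.
  have d0 : n%:R * S - 2%:R * G != 0.
    by apply: contraNneq w30 => d0; rewrite /w3 d0 mulr0.
  rewrite e3E nuE /c /w2 /w3 m2E; field.
  by rewrite d0 nr0 nr2 m0 two0 oppr_eq0 m0.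
have tr4 : mult M e4 = ((n - 1) * (n - 2))%N.
  apply: inj; rewrite /= (mM 3%N) //= !raddfB /= 3!mxtraceZ trZ trJ trB natrM !natrB //.
  by rewrite nuE /c m2E; field; rewrite w20 nr0 nr2 m0 two0.
have tr0 : (mult M 0 + (1 + (n - 1) + 'C(n - 1, 2) + (n - 1) * (n - 2)) = n`!)%N.
  have := mM 0%N isT; rewrite /= -/(mult M e1) tr1 => t1.
  have := mM 1%N isT; rewrite /= -/(mult M e2) tr2 => t2.
  have := mM 2%N isT; rewrite /= -/(mult M e3) tr3 => t3.
  have := mM 3%N isT; rewrite /= -/(mult M e4) tr4 => t4.
  have cardE : (#|{: {perm 'I_n}}|)%:R = (n`!)%:R :> F by rewrite card_Sn.
  have := mM 4%N isT; rewrite /= -/(mult M 0) raddfB /= mxtrace1 cardE.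
  rewrite mxtraceD -t4 mxtraceD -t3 mxtraceD -t2 -t1 -!natrD => t0.
  by apply: inj; rewrite /= natrD t0 subrK.
split=> // x; split=> [/eM //|xin].
(* Each listed value is a root of the characteristic polynomial because its multiplicity is
   positive. *)
have : (0 < mult M x)%N.
  move: xin; rewrite !inE => /or4P[/eqP->|/eqP->|/eqP->|/orP[]/eqP->].
  - by rewrite tr1.
  - by rewrite tr2 subn_gt0.
  - by rewrite tr3 bin_gt0.
  - by rewrite tr4 muln_gt0 !subn_gt0 n2.
  - by move: (fact_gt_dims n4); rewrite -tr0 -[X in (X < _)%N]add0n ltn_add2r.
rewrite eigenvalue_root_char; apply: contraTT => /mupNroot; rewrite /mult => ->.
by [].
Qed.

End Spectrum.

(** * Distinctness of the eigenvalues by specialization to real values *)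

Section Specialization.
Variables (R : realType) (n : nat) (v : ipair n -> R).

(* Sends [z] to 1 and [y p] to [v p]. *)
Definition specialize (P : yzring R n) : R :=
  (horner_eval 1 P).@[fun i => v (enum_val i)].

Lemma specialize_zmod : zmod_morphism specialize.
Proof. by move=> P Q; rewrite /specialize !raddfB. Qed.

Lemma specialize_monoid : monoid_morphism specialize.
Proof. by split=> [|P Q]; rewrite /specialize ?rmorph1 // !rmorphM. Qed.

HB.instance Definition _ := GRing.isZmodMorphism.Build (yzring R n) R specialize
  specialize_zmod.
HB.instance Definition _ := GRing.isMonoidMorphism.Build (yzring R n) R specialize
  specialize_monoid.

Lemma specialize_yvar p : specialize (yvar R p) = v p.
Proof. by rewrite /specialize /horner_eval hornerC mevalXU enum_rankK. Qed.

Lemma specialize_zvar : specialize (zvar R n) = 1.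
Proof. by rewrite /specialize /horner_eval hornerX rmorph1. Qed.

End Specialization.

(** A natural number that vanishes in the fraction field vanishes among the polynomials, and
    specialization carries this to [R]. *)
Lemma pchar_yzfield (R : realType) (n : nat) : [pchar yzfield R n] =i pred0.
Proof.
apply/pcharf0P => k; rewrite -(rmorph_nat (@tofrac (yzring R n))) tofrac_eq0.
apply/eqP/eqP => [k0|->//]; apply/eqP; rewrite -((pcharf0P R).1 (Num.Theory.pchar_num R)).
by rewrite -(rmorph_nat (specialize (fun _ : ipair n => 0 : R))) k0 rmorph0.
Qed.

Lemma IF_group_mx (R : realType) (n : nat) :
  IF R n = group_mx (fun s => \sum_(p in Inv s) tofrac (yvar R p)
                              + fixc (yzfield R n) s * tofrac (zvar R n)).
Proof.
apply/matrixP => a b; rewrite !mxE /inv_y /fix_z rmorphD rmorph_sum rmorphM /=.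
by rewrite rmorph_nat.
Qed.


(* The list of eigenvalues with [h] standing for [n! / 2], so that it makes sense
   over any ring. *)
Definition eigenvalues (K : comNzRingType) n (h : nat) (Y : ipair n -> K) (Z : K) :=
  [:: h%:R * (\sum_p Y p) + (n`!)%:R * Z;
      ((n - 2)`!)%:R * n%:R * Z
        - ((n - 2)`!)%:R * (\sum_p ((idx2 p)%:R - (idx1 p)%:R) * Y p);
      - ((n - 3)`!)%:R
        * (\sum_p (n%:R - 2%:R * ((idx2 p)%:R - (idx1 p)%:R)) * Y p);
      ((n - 2)`!)%:R * n%:R * Z; 0].

Lemma map_eigenvalues (K L : comNzRingType) (phi : {rmorphism K -> L}) n h
    (Y : ipair n -> K) (Y' : ipair n -> L) Z :
  (forall p, phi (Y p) = Y' p) ->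
  map phi (eigenvalues h Y Z) = eigenvalues h Y' (phi Z).
Proof.
move=> YY'; rewrite /= !(rmorphD, rmorphB, rmorphM, rmorphN, rmorph_sum, rmorph_nat, rmorph0).
congr [:: _ * _ + _; _ - _ * _; _ * _; _; _]; apply: eq_bigr => p _ //.
  by rewrite !(rmorphM, rmorphB, rmorph_nat) YY'.
by rewrite !(rmorphM, rmorphB, rmorph_nat) YY'.
Qed.

Lemma uniq_eigenvalues_delta (R : numFieldType) n h : (4 <= n)%N -> (n`! = h * 2)%N ->
  exists p0 : ipair n, uniq (eigenvalues h (fun p => (p == p0)%:R : R) 1).
Proof.
move=> n4 hE; pose a := (n - 2)`!; pose m := (n - 3)`!.
have nfact : (n`! = n * (n - 1) * a)%N.
  by rewrite /a; case: (n) n4 => [|[|k]] // _; rewrite !factS !subSS !subn0 mulnA.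
have afact : (a = (n - 2) * m)%N.
  by rewrite /a /m; case: (n) n4 => [|[|[|k]]] // _; rewrite !subSS !subn0 factS.
have a0 : (0 < a)%N by apply: fact_gt0.
have [p0 i0 i1] : exists2 p0 : ipair n, idx1 p0 = 0%N :> nat & idx2 p0 = 1%N :> nat.
  by exists (Sub (Ordinal (ltnW (ltnW (ltnW n4))), Ordinal (ltnW (ltnW n4))) isT).
exists p0; have sumE (f : ipair n -> R) : \sum_p f p * (p == p0)%:R = f p0.
  by rewrite (bigD1 p0) //= eqxx mulr1 big1 ?addr0 // => p /negPf->; rewrite mulr0.
have sum1 : \sum_p (p == p0)%:R = 1 :> R.
  by rewrite -[RHS](sumE (fun=> 1)); apply: eq_bigr => p _; rewrite mul1r.
(* For y the indicator of the pair (0, 1), of gap 1, and z = 1, adding (n-2)! to all five values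
   makes them natural numbers, to be compared in [nat]. *)
pose ks := [:: h + n`! + a; a * n; 0; a * n + a; a]%N.
have -> : eigenvalues h (fun p => (p == p0)%:R : R) 1 =
    map (fun k : nat => k%:R - a%:R) ks.
  rewrite /eigenvalues !sumE sum1 i0 i1 -/a -/m /= !natrD !natrM.
  have -> : a%:R = m%:R * (n%:R - 2%:R) :> R.
    by rewrite afact natrM natrB 1?mulrC //; apply: leq_trans n4.
  by congr [:: _; _; _; _; _]; ring.
rewrite map_inj_uniq => [|k l /addIr]; last first.
  exact: natr_inj_pchar0 (Num.Theory.pchar_num R) _ _.
rewrite /= !inE !negb_or; nia.
Qed.

Lemma eigenvalues_field (F : fieldType) n h (y : ipair n -> F) (z : F) :
  2%:R != 0 :> F -> (n`! = h * 2)%N ->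
  eigenvalues h y z =
    [:: (n`!)%:R / 2%:R * (\sum_p y p) + (n`!)%:R * z;
        ((n - 2)`!)%:R * n%:R * z - ((n - 2)`!)%:R * (\sum_p gap F p * y p);
        - ((n - 3)`!)%:R * (\sum_p (n%:R - 2%:R * gap F p) * y p);
        ((n - 2)`!)%:R * n%:R * z; 0].
Proof. by move=> two0 hE; rewrite /eigenvalues {2}hE natrM mulfK. Qed.

(** Elements with distinct images under a map are distinct, so one good choice of values v
    suffices. *)
Lemma uniq_eigenvalues (K : comNzRingType) (L : numFieldType) n h
    (Y : ipair n -> K) (Z : K) (phi : (ipair n -> L) -> {rmorphism K -> L}) :
  (forall v p, phi v (Y p) = v p) -> (forall v, phi v Z = 1) ->
  (4 <= n)%N -> (n`! = h * 2)%N -> uniq (eigenvalues h Y Z).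
Proof.
move=> phiY phiZ n4 hE; have [p0 U0] := uniq_eigenvalues_delta L n4 hE.
pose v (p : ipair n) : L := (p == p0)%:R.
by apply: (@map_uniq _ _ (phi v)); rewrite (map_eigenvalues _ _ (phiY v)) phiZ.
Qed.

Unset Implicit Arguments.

Theorem theorem1p1 (R : realType) (n : nat) (hn : (4 <= n)%N) :
  let y (p : ipair n) : yzfield R n := tofrac (yvar R p) in
  let z : yzfield R n := tofrac (zvar R n) in
  let gap (p : ipair n) : yzfield R n :=
    (idx2 p)%:R - (idx1 p)%:R in
  let e1 := (n`!)%:R / 2%:R * (\sum_(p : ipair n) y p) + (n`!)%:R * z in
  let e2 := ((n - 2)`!)%:R * n%:R * z
            - ((n - 2)`!)%:R * (\sum_(p : ipair n) gap p * y p) in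
  let e3 := - ((n - 3)`!)%:R
            * (\sum_(p : ipair n) (n%:R - 2%:R * gap p) * y p) in
  let e4 := ((n - 2)`!)%:R * n%:R * z in
  [/\ diagonalizable (IF R n),
      (forall x : yzfield R n,
          eigenvalue (IF R n) x <-> x \in [:: e1; e2; e3; e4; 0])
    & [/\ mult (IF R n) e1 = 1%N,
          mult (IF R n) e2 = (n - 1)%N,
          mult (IF R n) e3 = 'C(n - 1, 2),
          mult (IF R n) e4 = ((n - 1) * (n - 2))%N
        & (mult (IF R n) 0)%:R
            = (n`!)%:R - n%:R / 2%:R * (3%:R * n%:R - 7%:R) - 3%:R :> rat]].
Proof.
move=> y z gap' e1 e2 e3 e4.
have charF := @pchar_yzfield R n.
have Ues : uniq [:: e1; e2; e3; e4; 0].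
  have /dvdnP[h hE] : (2 %| n`!)%N by apply: dvdn_fact; apply: leq_trans hn.
  have two0 : 2%:R != 0 :> yzfield R n by rewrite ((pcharf0P _).1 charF).
  have := eigenvalues_field y z two0 hE.
  rewrite -/e1 => <-.
  (* The list is the image of one over the polynomial ring, which embeds into its fraction field and
     on which specialization is defined. *)
  rewrite -(map_eigenvalues h (zvar R n) (fun p => erefl (tofrac (yvar R p)))).
  rewrite map_inj_uniq; last by move=> P Q /eqP; rewrite tofrac_eq => /eqP.
  pose phi (v : ipair n -> R) : {rmorphism yzring R n -> R} := specialize v.
  have phiY v p : phi v (yvar R p) = v p by apply: specialize_yvar.
  have phiZ v : phi v (zvar R n) = 1 by apply: specialize_zvar.
  exact: (uniq_eigenvalues phiY phiZ hn hE).
rewrite IF_group_mx.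
have [dM eM [m1 m2 m3 m4 m0]] := spectrum_inv_fix charF hn Ues.
split=> //; split=> //.
have C2 : ('C(n - 1, 2))%:R = (n%:R - 1) * (n%:R - 2%:R) / 2%:R :> rat.
  have := congr1 (fun k => k%:R : rat) (binom2E (ltnW (ltnW hn))).
  rewrite /= !natrM !natrB ?(leq_trans _ hn) // => <-; by field.
(* The four other multiplicities add up to n (3n - 7) / 2 + 3. *)
rewrite -m0 !natrD natrM C2 !natrB ?(leq_trans _ hn) //; by field.
Qed.
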